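(* If $G$ is a graph of girth at least $5$ that has an isolatable vertex, then $G\Box K_2$ is not well-covered.
   Context: All graphs are finite and simple. A graph is well-covered if all its maximal independent sets have the same cardinality. The girth of a graph is the length of its shortest cycle ($\infty$ for forests). A vertex $w$ of a graph $X$ is isolatable in $X$ if there exists an independent set $J$ of $X$ such that $V(X)-N[J]=\{w\}$, where $N[J]$ is $J$ together with all vertices adjacent to some vertex of $J$. The Cartesian product $G \Box K_2$ has vertex set $V(G)\times\{1,2\}$, with $(g_1,i)$ adjacent to $(g_2,j)$ if either $g_1=g_2$ and $i\neq j$, or $i=j$ and $g_1g_2\in E(G)$.
   Formalization: The isolatable vertex is additionally required to have at least one neighbor; without this the claim fails for G = K_1, whose single vertex is isolatable while K_1 □ K_2 = K_2 is well-covered. *)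

(* Defs.v *)
From mathcomp Require Import all_boot.

Set Implicit Arguments.
Unset Strict Implicit.
Unset Printing Implicit Defensive.

Record sgraph := SGraph {
  vertex :> finType;
  adj : rel vertex;
  adj_sym : symmetric adj;
  adj_irrefl : irreflexive adj }.

Section Graph.
Variable G : sgraph.
Implicit Types (I J : {set G}) (w : G).

Definition independent : pred {set G} :=
  fun I => [forall x in I, forall y in I, ~~ adj x y].

Definition well_covered : Prop :=
  forall I J, maxset independent I -> maxset independent J -> #|I| = #|J|.

Definition closed_nbhd J : {set G} := J :|: [set x | [exists y in J, adj y x]].

Definition isolatable w : Prop :=
  exists2 J, independent J & [set: G] :\: closed_nbhd J = [set w].

(* An isolated vertex can be isolatable: in K_1 take [J = set0].  There the
   prism, K_2, is well-covered, so isolatable vertices of degree 0 have to be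
   set apart. *)
Definition isolated w : bool := [forall v, ~~ adj w v].

(* [ucycleb adj] also accepts single edges (length 2) as cycles, hence the
   bound [2 < n]. *)
Definition has_cycle (n : nat) : bool :=
  (2 < n) && [exists c : n.-tuple G, ucycleb (@adj G) c].

(* [None] stands for infinity; no cycle is longer than [#|G|]. *)
Definition girth : option nat := ohead [seq n <- iota 0 #|G|.+1 | has_cycle n].

Definition girth_at_least (k : nat) : bool :=
  if girth is Some n then k <= n else true.

Lemma girth_at_leastP k :
  reflect (forall c : seq G, 2 < size c -> ucycle (@adj G) c -> k <= size c)
          (girth_at_least k).
Proof.
rewrite /girth_at_least /girth.
have mem_s (c : seq G) : 2 < size c -> ucycle (@adj G) c ->
    size c \in [seq n <- iota 0 #|G|.+1 | has_cycle n].
  move=> c_gt2 uc; rewrite mem_filter mem_iota /= add0n ltnS.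
  rewrite /has_cycle c_gt2 /=; apply/andP; split.
    by apply/existsP; exists (in_tuple c).
  by have /andP[_ /card_uniqP <-] := uc; apply: max_card.
have : sorted ltn [seq n <- iota 0 #|G|.+1 | has_cycle n].
  by apply: sorted_filter; [exact: ltn_trans | exact: iota_ltn_sorted].
case Es: [seq _ <- _ | _] mem_s => [|n s] mem_s /= s_sorted.
  by apply: ReflectT => c c_gt2 /(mem_s _ c_gt2).
apply: (iffP idP) => [le_kn c c_gt2 /(mem_s _ c_gt2)|].
  rewrite inE => /predU1P[-> // | c_s]; apply: leq_trans le_kn _.
  by apply: ltnW; apply: (allP (order_path_min ltn_trans s_sorted)).
have : n \in [seq n <- iota 0 #|G|.+1 | has_cycle n] by rewrite Es mem_head.
rewrite mem_filter => /andP[/andP[n_gt2 /existsP[c uc]] _] le_k.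
by rewrite -(size_tuple c); apply: le_k; rewrite ?size_tuple.
Qed.

(* The Cartesian product of [G] with K_2, whose vertices are the booleans. *)
Definition prism_adj : rel (G * bool) :=
  fun u v => (u.1 == v.1) && (u.2 != v.2) || (u.2 == v.2) && adj u.1 v.1.

Lemma prism_adj_sym : symmetric prism_adj.
Proof.
by move=> u v; rewrite /prism_adj eq_sym (eq_sym u.2) (adj_sym u.1).
Qed.

Lemma prism_adj_irrefl : irreflexive prism_adj.
Proof. by move=> u; rewrite /prism_adj !eqxx adj_irrefl. Qed.

Definition prism : sgraph := SGraph prism_adj_sym prism_adj_irrefl.

End Graph.

(* Main.v *)
Require Import Defs.
From mathcomp Require Import all_boot.

(* Suppose the prism is well-covered.  Its independent sets are the pairs (A, B)
   of disjoint independent sets of G, so all maximal pairs have the same total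
   size.  Fix a vertex w with a neighbor, and call J isolating if J misses N[w]
   and meets N(u) for every neighbor u of w.  If J is isolating and T is
   disjoint from J and from N[w], then T cannot dominate N(v) - w - J, for v in
   N(w): in a maximal pair (P, Q) extending (J, T + w) one could replace Q by Q - w
   plus all neighbors of w undominated by Q - w (v among them), and P by P + w.
   Hence T extends to an isolating set disjoint from J.
   It follows that for each z in N(v) - w some isolating T contains N(v) - w - z
   but not z, and then N(z) - v is contained in T.  For another neighbor u of w,
   take t in T and N(u), and an isolating J disjoint from T, containing z and
   N(u) - w - t.  In a maximal pair extending (J, T + w), replace z by v on one
   side, and t and w by u on the other: the total size drops by one, and the only
   vertices that may be added back are t on the first side, if N(t) is included
   in {u, z}, and z on the second, if N(z) is included in {v, t}.  So exactly one
   of these inclusions holds.  But the same facts force z and t to have exactly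
   one neighbor in N(x) - w for each other neighbor x of w, and no further ones:
   either both inclusions hold (deg w = 2) or both fail (deg w > 2). *)

Set Implicit Arguments.
Unset Strict Implicit.
Unset Printing Implicit Defensive.

(** * Preliminaries on disjoint and independent sets *)

Lemma disjoints_setU1 (T : finType) (x : T) (A B : {set T}) :
  [disjoint A & x |: B] = (x \notin A) && [disjoint A & B].
Proof.
rewrite !(disjoint_sym A) -disjointU1; apply: eq_disjoint => y.
by rewrite !inE.
Qed.

Section Independent.
Variable G : sgraph.
Implicit Types (A B I : {set G}) (x y : G).

Lemma independentP I :
  reflect {in I &, forall x y, ~~ adj x y} (independent I).
Proof.
apply: (iffP forall_inP) => [indI x y xI yI | indI x xI].
  exact: (forall_inP (indI x xI)).
by apply/forall_inP => y yI; apply: indI.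
Qed.

Lemma independentS A B : A \subset B -> independent B -> independent A.
Proof.
move=> /subsetP sAB /independentP indB; apply/independentP => x y xA yA.
by apply: indB; apply: sAB.
Qed.

Lemma independentU1 x A :
  independent A -> {in A, forall y, ~~ adj x y} -> independent (x |: A).
Proof.
move=> /independentP indA xA; apply/independentP => y z.
rewrite !inE => /predU1P[->|yA] /predU1P[->|zA]; rewrite ?adj_irrefl //.
- exact: xA.
- by rewrite adj_sym; apply: xA.
- exact: indA.
Qed.

Definition touches x A : bool := [exists y in A, adj x y].

Lemma touchesP x A : reflect (exists2 y, y \in A & adj x y) (touches x A).
Proof. exact: exists_inP. Qed.

End Independent.

(** * Excluding triangles and 4-cycles *)

Section Girth5.
Variable G : sgraph.
Hypothesis girthG : girth_at_least G 5.
Implicit Types x y z : G.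

Lemma adj_neq x y : adj x y -> x != y.
Proof. by apply: contraTneq => ->; rewrite adj_irrefl. Qed.

Lemma no_triangle x y z : adj x y -> adj x z -> ~~ adj y z.
Proof.
move=> xy xz; apply/negP => yz.
have /girth_at_leastP/(_ [:: x; y; z] isT) := girthG.
suff uc: ucycle (@adj G) [:: x; y; z] by move/(_ uc).
rewrite /ucycle /= xy yz (adj_sym z) xz !inE !negb_or.
by rewrite (adj_neq xy) (adj_neq xz) (adj_neq yz).
Qed.

(** A second common neighbor would close the 4-cycle [x], [a], [y], [b]. *)
Lemma common_neighbor x y a b :
  x != y -> adj x a -> adj y a -> adj x b -> adj y b -> a = b.
Proof.
move=> neq_xy xa ya xb yb; apply/eqP/negPn/negP => neq_ab.
have /girth_at_leastP/(_ [:: x; a; y; b] isT) := girthG.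
suff uc: ucycle (@adj G) [:: x; a; y; b] by move/(_ uc).
rewrite /ucycle /= xa (adj_sym a) ya yb (adj_sym b) xb !inE !negb_or.
by rewrite (adj_neq xa) neq_xy (adj_neq xb) (eq_sym a y) (adj_neq ya) neq_ab (adj_neq yb).
Qed.

End Girth5.

(** * Independent sets of the prism as pairs of sets of [G] *)

Section Layers.
Variable G : sgraph.
Implicit Types (A B : {set G}) (x y : G).

(* The copy of [G] indexed by [true] carries the first set. *)
Definition layers A B : {set prism G} :=
  [set p : prism G | if p.2 then p.1 \in A else p.1 \in B].

Lemma card_layers A B : #|layers A B| = #|A| + #|B|.
Proof.
have -> : layers A B = [set (x, true) | x in A] :|: [set (x, false) | x in B].
  apply/setP => -[x []]; rewrite !inE /=.
    apply/idP/orP => [xA | [] /imsetP[y yA [->]] //].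
    by left; apply: imset_f.
  apply/idP/orP => [xA | [] /imsetP[y yA [->]] //].
  by right; apply: imset_f.
rewrite cardsU !card_imset; try by move=> x y [].
rewrite (_ : _ :&: _ = set0) ?cards0 ?subn0 //.
apply/setP => p; rewrite !inE; apply/negP.
by case/andP => /imsetP[x _ ->] /imsetP[y _].
Qed.

Definition indep_pair A B : bool :=
  [&& independent A, independent B & [disjoint A & B]].

(** Maximality seen from the layer of [A]: a vertex is kept out either by its twin in the other
    layer or by a neighbor in [A]. *)
Definition dominates A B : Prop :=
  forall x, x \notin A -> x \in B \/ touches x A.

Definition max_pair A B : Prop :=
  [/\ indep_pair A B, dominates A B & dominates B A].

Lemma independent_layers A B : independent (layers A B) = indep_pair A B.
Proof.
apply/independentP/and3P => [indAB | [/independentP indA /independentP indB dAB]].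
  split.
  - apply/independentP => x y xA yA.
    by have := indAB (x, true) (y, true); rewrite !inE /= /prism_adj /= andbF => ->.
  - apply/independentP => x y xA yA.
    by have := indAB (x, false) (y, false); rewrite !inE /= /prism_adj /= andbF => ->.
  apply/pred0P => x /=; apply/negP => /andP[xA xB].
  have := indAB (x, true) (x, false).
  by rewrite !inE /= /prism_adj /= eqxx => /(_ xA xB).
move=> [x []] [y []]; rewrite !inE /= /prism_adj /= ?andbF ?andbT ?orbF /=.
- exact: indA.
- by move=> xA yB; apply: contraTneq yB => <-; rewrite (disjointFr dAB).
- by move=> xB yA; apply: contraTneq yA => <-; rewrite (disjointFl dAB).
- exact: indB.
Qed.

Lemma layers_preim (S : {set prism G}) :
  S = layers [set x | (x, true) \in S] [set x | (x, false) \in S].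
Proof. by apply/setP => -[x []]; rewrite !inE. Qed.

Lemma max_pair_layers A B :
  max_pair A B -> maxset (@independent (prism G)) (layers A B).
Proof.
move=> [indAB domA domB]; apply/maxsetP; split; first by rewrite independent_layers.
move=> S indS /subsetP sS; apply/eqP; rewrite eqEsubset; apply/andP; split; last exact/subsetP.
move/independentP: indS => indS.
apply/subsetP => -[x b] xS; rewrite !inE /=; case: b xS => xS; apply/negPn/negP => xN.
  case: (domA x xN) => [xB | /touchesP[y yA xy]].
    by have := indS _ _ xS (sS (x, false) _); rewrite !inE /= /prism_adj /= eqxx => /(_ xB).
  by have := indS _ _ xS (sS (y, true) _); rewrite !inE /= /prism_adj /= xy orbT => /(_ yA).
case: (domB x xN) => [xB | /touchesP[y yA xy]].
  by have := indS _ _ xS (sS (x, true) _); rewrite !inE /= /prism_adj /= eqxx => /(_ xB).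
by have := indS _ _ xS (sS (y, false) _); rewrite !inE /= /prism_adj /= xy orbT => /(_ yA).
Qed.

Lemma extend_indep_pair A B : indep_pair A B ->
  exists A' B', [/\ A \subset A', B \subset B' & max_pair A' B'].
Proof.
rewrite -independent_layers => /maxset_exists[S /maxsetP[indS maxS] /subsetP sS].
exists [set x | (x, true) \in S], [set x | (x, false) \in S].
split; try by apply/subsetP => x xA; rewrite inE; apply: sS; rewrite inE.
split; first by rewrite -independent_layers -layers_preim.
- move=> x; rewrite !inE => xS; case: (boolP ((x, false) \in S)) => xS'; [by left | right].
  apply/touchesP; apply/exists_inP; apply: contraNT xS => /exists_inPn noS.
  rewrite -(maxS ((x, true) |: S)) ?setU11 ?subsetUr //.
  apply: independentU1 => // -[y []] yS; rewrite /= /prism_adj /= ?andbF ?andbT ?orbF /=.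
    by apply: noS; rewrite inE.
  by apply: contraNneq xS' => ->.
- move=> x; rewrite !inE => xS; case: (boolP ((x, true) \in S)) => xS'; [by left | right].
  apply/touchesP; apply/exists_inP; apply: contraNT xS => /exists_inPn noS.
  rewrite -(maxS ((x, false) |: S)) ?setU11 ?subsetUr //.
  apply: independentU1 => // -[y []] yS; rewrite /= /prism_adj /= ?andbF ?andbT ?orbF /=.
    by apply: contraNneq xS' => ->.
  by apply: noS; rewrite inE.
Qed.

Lemma card_max_pair A B A' B' : well_covered (prism G) ->
  max_pair A B -> max_pair A' B' -> #|A| + #|B| = #|A'| + #|B'|.
Proof.
move=> wc /max_pair_layers mAB /max_pair_layers mAB'.
by rewrite -!card_layers; apply: wc.
Qed.

Lemma card_indep_pair A B A' B' : well_covered (prism G) ->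
  indep_pair A B -> max_pair A' B' -> #|A| + #|B| <= #|A'| + #|B'|.
Proof.
move=> wc /extend_indep_pair[P [Q [sAP sBQ mPQ]]] mAB'.
by rewrite -(card_max_pair wc mPQ mAB') leq_add ?subset_leq_card.
Qed.

End Layers.

(** * Isolating sets and their extensions *)

Section Isolatable.
Variables (G : sgraph) (w : G).
Hypothesis girthG : girth_at_least G 5.
Hypothesis wc : well_covered (prism G).
Implicit Types (J T : {set G}) (x y z t u v : G).

Definition admissible J : bool := (w \notin J) && independent (w |: J).

(** Weaker than a witness of [isolatable w]: vertices at distance 2 or more from [w] may stay
    undominated, so the property passes to larger admissible sets. *)
Definition isolating J : bool :=
  admissible J && [forall (v | adj w v), touches v J].

Lemma admissibleP J :
  reflect [/\ independent J, w \notin J & {in J, forall x, ~~ adj w x}]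
          (admissible J).
Proof.
apply: (iffP andP) => [[wJ ind_wJ] | [indJ wJ nwJ]].
  split=> //; first by apply: independentS ind_wJ; apply: subsetUr.
  by move=> x xJ; apply: (independentP _ ind_wJ); rewrite ?setU11 // setU1r.
by split=> //; apply: independentU1.
Qed.

Lemma isolatingP J :
  reflect (admissible J /\ forall v, adj w v -> touches v J) (isolating J).
Proof. by apply: (iffP andP) => -[aJ] /forall_inP. Qed.

Lemma isolatable_isolating : isolatable w -> exists J, isolating J.
Proof.
case=> J /independentP indJ eqJ; exists J.
have wN : w \notin closed_nbhd J.
  by have := set11 w; rewrite -eqJ in_setD in_setT andbT.
have [wJ nwJ] : w \notin J /\ {in J, forall x, ~~ adj w x}.
  move: wN; rewrite !inE negb_or => /andP[-> /exists_inPn nwJ]; split=> // x xJ.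
  by rewrite adj_sym; apply: nwJ.
apply/isolatingP; split; first by apply/admissibleP; split=> //; apply/independentP.
move=> v wv; have : v \notin [set w] by rewrite inE eq_sym adj_neq.
rewrite -eqJ in_setD in_setT andbT negbK !inE => /orP[vJ | /exists_inP[y yJ yv]].
  by rewrite (negbTE (nwJ v vJ)) in wv.
by apply/touchesP; exists y; rewrite // adj_sym.
Qed.

Lemma undominated_neighbor J T v :
    isolating J -> admissible T -> [disjoint J & T] -> adj w v ->
  exists y, [/\ adj v y, y != w, y \notin J & ~~ touches y T].
Proof.
move=> /isolatingP[/admissibleP[indJ wJ nwJ] hitJ] /admissibleP[indT wT nwT] dJT wv.
suff /exists_inP[y vy /and3P[yw yJ yT]] :
    [exists (y | adj v y), [&& y != w, y \notin J & ~~ touches y T]].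
  by exists y.
apply: contraT => /exists_inPn noy.
have [P [Q [sJP /subsetP sTQ mPQ]]] : exists P Q : {set G},
    [/\ J \subset P, (w |: T) \subset Q & max_pair P Q].
  apply: extend_indep_pair; rewrite /indep_pair indJ independentU1 //=.
  by rewrite disjoints_setU1 wJ.
have wQ : w \in Q by rewrite sTQ ?setU11.
have [/and3P[/independentP indP /independentP indQ dPQ] domP domQ] := mPQ.
have wP : w \notin P by rewrite (disjointFl dPQ wQ).
have nwP x : x \in P -> ~~ adj w x.
  move=> xP; apply/negP => /hitJ/touchesP[y yJ xy].
  by have := indP _ _ xP (subsetP sJP _ yJ); rewrite xy.
(* The neighbors of [w] that only [w] dominates in [Q]; they become free once [w] leaves [Q]. *)
pose L := [set u | adj w u && ~~ touches u (Q :\ w)].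
(* A neighbor of [v] in [Q :\ w] is not in [J], which lies in [P], and has no neighbor in [T], which
   lies in [Q]; [noy] excludes such a vertex. *)
have vL : v \in L.
  rewrite inE wv; apply/touchesP => -[y]; rewrite !inE => /andP[yw yQ] vy.
  have /negP[] := noy y vy; rewrite yw /=; apply/andP; split.
    by apply: contraL yQ => yJ; rewrite (disjointFr dPQ) ?(subsetP sJP).
  apply/touchesP => -[x xT yx]; have := indQ _ _ yQ (sTQ x _).
  by rewrite yx setU1r // => /(_ isT).
have mPL : max_pair (w |: P) (L :|: Q :\ w).
  split.
  - apply/and3P; split.
    + by apply: independentU1 => //; apply/independentP.
    + apply/independentP => x y; rewrite !inE.
      case/orP=> [/andP[wx xQ]|/andP[xw xQ]]; case/orP=> [/andP[wy yQ]|/andP[yw yQ]].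
      * exact: (no_triangle girthG wx).
      * by apply: contraNN xQ => xy; apply/touchesP; exists y; rewrite // !inE yw.
      * apply: contraNN yQ => xy; apply/touchesP; exists x; rewrite ?inE ?xw //.
        by rewrite adj_sym.
      * exact: indQ.
    + apply/pred0P => x /=; apply/negP; rewrite !inE => /andP[].
      case/predU1P=> [->|xP]; first by rewrite adj_irrefl eqxx.
      by rewrite (negbTE (nwP x xP)) (disjointFr dPQ xP) andbF.
  - move=> x; rewrite !inE negb_or => /andP[xw /domP[xQ|/touchesP[y yP xy]]].
      by left; rewrite xw xQ orbT.
    by right; apply/touchesP; exists y; rewrite // setU1r.
  - move=> x; rewrite !inE negb_or.
    case: (eqVneq x w) => [->|xw]; first by left.
    rewrite /= => /andP[xL /domQ[xP|/touchesP[y yQ xy]]]; first by left.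
    right; apply/touchesP; case: (eqVneq y w) => [yw|yw].
      move: xL; rewrite -yw adj_sym xy negbK yw => /touchesP[a aQ xa].
      by exists a; rewrite // inE aQ orbT.
    by exists y; rewrite // !inE yw yQ orbT.
(* Moving [w] between the layers is neutral, so the total grows by [#|L|], which is positive because
   of [v]. *)
have := card_max_pair wc mPQ mPL.
rewrite cardsU1 wP cardsU [X in _ - X](_ : _ = 0); last first.
  apply: eq_card0 => x; rewrite !inE; apply/negP.
  case/andP => /andP[wx _] /andP[_ xQ].
  by have := indQ _ _ wQ xQ; rewrite wx.
rewrite (cardsD1 w Q) wQ (cardsD1 v L) vL subn0.
by move/eqP; rewrite add1n !addSn addnS eqSS eqn_add2l ltn_eqF // ltnS leq_addl.
Qed.

(** Take [T'] maximal among the admissible supersets of [T] disjoint from [J]. The vertex that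
    [undominated_neighbor] finds next to [v] could be added to [T'], hence belongs to it. *)
Lemma extend_isolating J T :
    isolating J -> admissible T -> [disjoint J & T] ->
  exists T', [/\ T \subset T', isolating T' & [disjoint J & T']].
Proof.
move=> isoJ aT dJT.
have [T' /maxsetP[/andP[aT' dJT'] maxT'] sTT'] :=
  @maxset_exists _ [pred X | admissible X && [disjoint J & X]] T
    (introT andP (conj aT dJT)).
exists T'; split=> //; apply/isolatingP; split=> // v wv.
have [y [vy yw yJ yT']] := undominated_neighbor isoJ aT' dJT' wv.
apply/touchesP; exists y => //.
rewrite -(maxT' (y |: T')) ?setU11 ?subsetUr //=.
have /admissibleP[indT' wT' nwT'] := aT'.
apply/andP; split; last by rewrite disjoints_setU1 yJ.
apply/admissibleP; split.
- apply: independentU1 => // x xT'; apply: contraNN yT' => yx.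
  by apply/touchesP; exists x.
- by rewrite !inE negb_or eq_sym yw.
- move=> x /setU1P[->|]; last exact: nwT'.
  by apply: contraL vy; apply: (no_triangle girthG).
Qed.

Lemma isolating_misses J v :
  isolating J -> adj w v -> exists z, [/\ adj v z, z != w & z \notin J].
Proof.
move=> isoJ wv.
have [||z [vz zw zJ _]] := @undominated_neighbor J set0 v isoJ _ _ wv.
- apply/admissibleP; split; rewrite ?inE //; last by move=> x; rewrite inE.
  by apply/independentP => x y; rewrite inE.
- by rewrite -setI_eq0 setI0.
by exists z.
Qed.

(** * Isolating sets omitting one neighbor of [v] *)

(* [T] contains all neighbors of [v] other than [w] and [z]. *)
Definition omits v z T : bool :=
  [&& isolating T, z \notin T &
      [forall (y | adj v y), (y != w) ==> (y != z) ==> (y \in T)]].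

Lemma omitsP v z T :
  reflect [/\ isolating T, z \notin T &
             forall y, adj v y -> y != w -> y != z -> y \in T]
          (omits v z T).
Proof.
apply: (iffP and3P) => -[isoT zT] => [/forall_inP allT | allT]; split=> //.
  by move=> y /allT/implyP yT yw; apply/implyP; apply: yT.
by apply/forall_inP => y vy; apply/implyP => yw; apply/implyP; apply: allT.
Qed.

Lemma isolating_notin T v : isolating T -> adj w v -> v \notin T.
Proof.
case/isolatingP=> /admissibleP[_ _ nwT] _.
by apply: contraL => /nwT.
Qed.

(** If [y] were not in [T], then [undominated_neighbor] with [[set y]] would give a vertex of N(v) -
    w outside [T] and not adjacent to [y]; but only [z] is left outside [T]. *)
Lemma omits_sub_neighbors v z T : adj w v -> adj v z -> z != w ->
  omits v z T -> forall y, adj z y -> y != v -> y \in T.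
Proof.
move=> wv vz zw /omitsP[isoT zT allT] y zy yv; apply: contraT => yT.
have wz : ~~ adj w z by apply: contraL vz; apply: (no_triangle girthG).
have [||x [vx xw xT]] := @undominated_neighbor T [set y] v isoT _ _ wv.
- apply/admissibleP; split.
  + by apply/independentP => a b /set1P-> /set1P->; rewrite adj_irrefl.
  + by rewrite inE; apply: contraNneq wz => ->; rewrite adj_sym.
  + move=> _ /set1P->; apply: contraNN yv => wy; apply/eqP.
    by apply: (common_neighbor girthG zw); rewrite // adj_sym.
- by rewrite disjoint_sym disjoints1.
have [->|xz] := eqVneq x z; last by rewrite allT in xT.
by case/touchesP; exists y; rewrite ?set11.
Qed.

(** If [v] were the only neighbor of [z], then [z |: T] would be isolating and contain all of N(v) -
    w, against [isolating_misses]. *)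
Lemma omits_extra_neighbor v z T : adj w v -> adj v z -> z != w ->
  omits v z T -> exists2 y, adj z y & y != v.
Proof.
move=> wv vz zw /omitsP[isoT zT allT].
suff /exists_inP[y] : [exists (y | adj z y), y != v] by exists y.
apply: contraT => /exists_inPn noy.
have [/admissibleP[indT wT nwT] hitT] := isolatingP _ isoT.
have [|x [vx xw]] := @isolating_misses (z |: T) v _ wv.
  apply/isolatingP; split.
    apply/admissibleP; split.
    - apply: independentU1 => // y yT; apply/negP => zy.
      have := noy y zy; rewrite negbK => /eqP yv.
      by have := isolating_notin isoT wv; rewrite -yv yT.
    - by rewrite !inE negb_or eq_sym zw.
    - move=> x /setU1P[->|]; last exact: nwT.
      by apply: contraL vz; apply: (no_triangle girthG).
  move=> u /hitT/touchesP[y yT uy]; apply/touchesP; exists y => //.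
  exact: setU1r.
rewrite !inE negb_or => /andP[xz]; by rewrite allT.
Qed.

(** In an inclusion-minimal [T'], deleting a vertex [x] not adjacent to [v] can only fail by leaving
    some neighbor [u] of [w] undominated; then [x] is the private neighbor of [u] in [T']. *)
Lemma minimal_omits v z T : omits v z T ->
  exists2 T', omits v z T' &
    {in T', forall x, ~~ adj v x ->
       exists u, [/\ adj w u, adj u x & {in T', forall y, adj u y -> y = x}]}.
Proof.
case/(@minset_exists _ (omits v z)) => T' /minsetP[omT' minT'] _.
exists T' => // x xT' nvx.
have [isoT' zT' allT'] := omitsP _ _ _ omT'.
have [aT' hitT'] := isolatingP _ isoT'.
suff /exists_inP[u wu uT'] : [exists (u | adj w u), ~~ touches u (T' :\ x)].
  have uniq_x : {in T', forall y, adj u y -> y = x}.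
    move=> y yT' uy; apply/eqP; apply: contraNT uT' => yx.
    by apply/touchesP; exists y; rewrite // !inE yx.
  exists u; split=> //; have /touchesP[y yT' uy] := hitT' u wu.
  by rewrite -(uniq_x y yT' uy).
apply: contraT => /exists_inPn noy.
have := setD11 x T'; rewrite (minT' (T' :\ x)) ?xT' ?subD1set //.
apply/omitsP; split.
- apply/isolatingP; split; last by move=> u wu; have := noy u wu; rewrite negbK.
  have /admissibleP[indT' wT' nwT'] := aT'; apply/admissibleP; split.
  + by apply: independentS indT'; apply: subD1set.
  + by rewrite !inE (negbTE wT') andbF.
  + by move=> y; rewrite !inE => /andP[_ /nwT'].
- by rewrite !inE (negbTE zT') andbF.
- move=> y vy yw yz; rewrite !inE allT' // andbT.
  by apply: contraNneq nvx => <-.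
Qed.

(** Since [J] meets N(v) at most in [z], the set N(v) - w - z is disjoint from [J] and can be
    extended by [extend_isolating]. *)
Lemma extend_omits v z J : isolating J -> adj w v -> z \in J ->
    {in J, forall x, adj v x -> x = z} ->
  exists2 T, omits v z T & [disjoint J & T].
Proof.
move=> isoJ wv zJ uniq_z.
have [||T [/subsetP sT isoT dJT]] :=
  @extend_isolating J [set y | [&& adj v y, y != w & y != z]] isoJ.
- apply/admissibleP; split.
  + apply/independentP => x y; rewrite !inE => /and3P[vx _ _] /and3P[vy _ _].
    exact: (no_triangle girthG vx).
  + by rewrite !inE eqxx andbF.
  + move=> x; rewrite inE => /andP[vx _].
    by apply: contraL vx; apply: (no_triangle girthG).
- apply/pred0P => x /=; apply/negP; rewrite inE => /andP[xJ /and3P[vx _]].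
  by rewrite (uniq_z x xJ vx) eqxx.
exists T => //; apply/omitsP; split=> //; first by rewrite (disjointFr dJT).
by move=> y vy yw yz; apply: sT; rewrite inE vy yw.
Qed.

(** * The exchange between two neighbors of [w] *)

(* The two sides say that [t], resp. [z], cannot be added back after the swap
   [z -> v], [{t, w} -> u]. *)
Lemma exchange u v z t J T :
    adj w v -> adj w u -> u != v -> adj v z -> z != w -> adj u t -> t != w ->
    omits v z T -> omits u t J -> [disjoint J & T] -> z \in J -> t \in T ->
  [exists y, [&& adj t y, y != u & y != z]]
    != [exists y, [&& adj z y, y != v & y != t]].
Proof.
move=> wv wu uv vz zw ut tw omT omJ dJT zJ tT.
have nzT := omits_sub_neighbors wv vz zw omT.
have ntJ := omits_sub_neighbors wu ut tw omJ.
have [isoT zT allT] := omitsP _ _ _ omT; have [isoJ tJ allJ] := omitsP _ _ _ omJ.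
have [/admissibleP[indJ wJ nwJ] hitJ] := isolatingP _ isoJ.
have [/admissibleP[indT wT nwT] hitT] := isolatingP _ isoT.
have nwz : ~~ adj w z by apply: nwJ.
(* [t] and [w] have no common neighbor besides [u]. *)
have nut : forall x, adj w x -> adj x t -> x = u.
  move=> x wx xt; apply/eqP/negPn/negP => xu.
  by case/eqP: tw; apply: (common_neighbor girthG xu); rewrite // adj_sym.
have [P [Q [/subsetP sJP /subsetP sTQ mPQ]]] : exists P Q : {set G},
    [/\ J \subset P, (w |: T) \subset Q & max_pair P Q].
  apply: extend_indep_pair; rewrite /indep_pair indJ independentU1 //=.
  by rewrite disjoints_setU1 wJ.
have wQ : w \in Q by rewrite sTQ ?setU11.
have {}sTQ x : x \in T -> x \in Q by move=> xT; rewrite sTQ ?setU1r.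
have [/and3P[/independentP indP /independentP indQ dPQ] domP domQ] := mPQ.
have wP : w \notin P by rewrite (disjointFl dPQ wQ).
have zP := sJP z zJ; have tQ := sTQ t tT.
have zQ : z \notin Q by rewrite (disjointFr dPQ zP).
have tP : t \notin P by rewrite (disjointFl dPQ tQ).
have nP x : adj w x -> x \notin P.
  by move=> /hitJ/touchesP[y yJ xy]; apply: contraL xy => xP; apply: indP (sJP _ yJ).
have nQ x : adj w x -> x \notin Q.
  by move=> wx; apply: contraL wx => xQ; apply: indQ.
have vP := nP v wv; have uP := nP u wu; have vQ := nQ v wv; have uQ := nQ u wu.
(* All other neighbors of [v] lie in [w |: T], hence in [Q]. *)
have vPz x : x \in P -> adj v x -> x = z.
  move=> xP vx; apply/eqP; apply: contraLR xP => xz.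
  have [-> //|xw] := eqVneq x w.
  by rewrite (disjointFl dPQ) // sTQ // allT.
have uQt x : x \in Q :\ w -> adj u x -> x = t.
  rewrite !inE => /andP[xw xQ] ux; apply/eqP; apply: contraLR xQ => xt.
  by rewrite (disjointFr dPQ) // sJP // allJ.
pose A := v |: P :\ z; pose B := u |: (Q :\ w) :\ t.
have tQw : t \in Q :\ w by rewrite !inE tw.
have cardAB : (#|A| + #|B|).+1 = #|P| + #|Q|.
  rewrite !cardsU1 !inE (negbTE vP) (negbTE uQ) !andbF /=.
  by rewrite (cardsD1 z P) zP (cardsD1 w Q) wQ (cardsD1 t (Q :\ w)) tQw !add1n !addSn !addnS.
have indA : independent A.
  apply: independentU1.
    by apply: (independentS (subD1set _ _)); apply/independentP.
  move=> x; rewrite !inE => /andP[xz xP].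
  by apply: contraNN xz => vx; rewrite (vPz x xP vx).
have indB : independent B.
  apply: independentU1.
    apply: (@independentS _ _ Q); last exact/independentP.
    by rewrite (subset_trans (subD1set _ _)) ?subD1set.
  move=> x; rewrite in_setD1 => /andP[xt xQ].
  by apply: contraNN xt => ux; rewrite (uQt x xQ ux).
have dAB : [disjoint A & B].
  apply/pred0P => x /=; apply/negP; rewrite !inE => /andP[].
  case/predU1P=> [->|/andP[xz xP]]; case/predU1P=> [xu|/and3P[xt xw xQ]].
  - by rewrite xu eqxx in uv.
  - by rewrite xQ in vQ.
  - by rewrite -xu xP in uP.
  - by rewrite (disjointFr dPQ xP) in xQ.
case: (boolP [exists y, _]) => [/existsP[y /and3P[ty yu yz]]|/existsPn noy];
  case: (boolP [exists y, _]) => [/existsP[y' /and3P[zy' y'v y't]]|/existsPn noy'] //.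
(* Both vertices exist: [y] keeps [t] out of [A] and [y'] keeps [z] out of [B], so the smaller pair
   is already maximal. *)
- suff mAB : max_pair A B.
    by move/eqP: (card_max_pair wc mPQ mAB); rewrite -cardAB gtn_eqF.
  have sQ x : x \in Q -> x \notin A -> x \in B \/ touches x A.
    move=> xQ _; have [->|xw] := eqVneq x w.
      by right; apply/touchesP; exists v; rewrite ?setU11.
    have [->|xt] := eqVneq x t; last by left; rewrite !inE xt xw xQ orbT.
    by right; apply/touchesP; exists y; rewrite // !inE yz sJP ?orbT // ntJ.
  have sP x : x \in P -> x \notin B -> x \in A \/ touches x B.
    move=> xP _; have [->|xz] := eqVneq x z; last by left; rewrite !inE xz xP orbT.
    right; apply/touchesP; exists y' => //; rewrite !inE y't sTQ ?nzT // andbT.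
    by apply/orP; right; apply: contraNneq nwz => <-; rewrite adj_sym.
  split; first by rewrite /indep_pair indA indB.
  + move=> x xA; have [->|xz] := eqVneq x z.
      by right; apply/touchesP; exists v; rewrite ?setU11 // adj_sym.
    have xP : x \notin P by apply: contraNN xA => xP; rewrite !inE xz xP orbT.
    have [xQ|/touchesP[p pP xp]] := domP x xP; first exact: sQ.
    (* A vertex that was dominated by the removed [z] is a neighbor of [z] other than [v], so it
       lies in [T]. *)
    have [pz|pz] := eqVneq p z.
      apply: sQ => //; apply/sTQ/nzT; first by rewrite -pz adj_sym.
      by apply: contraNneq xA => ->; rewrite setU11.
    by right; apply/touchesP; exists p; rewrite // !inE pz pP orbT.
  + move=> x xB; have [->|xw] := eqVneq x w.
      by right; apply/touchesP; exists u; rewrite ?setU11.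
    have [->|xt] := eqVneq x t.
      by right; apply/touchesP; exists u; rewrite ?setU11 // adj_sym.
    have xQ : x \notin Q by apply: contraNN xB => xQ; rewrite !inE xt xw xQ orbT.
    have [xP|/touchesP[q qQ xq]] := domQ x xQ; first exact: sP.
    have xu : x != u by apply: contraNneq xB => ->; rewrite setU11.
    (* A neighbor [x] of [w] is still dominated by [T], and not through the removed [t], since [x]
       differs from [u]. *)
    have [qw|qw] := eqVneq q w.
      have wx : adj w x by rewrite -qw adj_sym.
      have /touchesP[a aT xa] := hitT x wx.
      right; apply/touchesP; exists a => //; rewrite !inE sTQ // andbT.
      apply/orP; right; apply/andP; split.
        by apply: contraNneq xu => eq_at; apply/eqP/nut; rewrite -?eq_at.
      by apply: contraNneq wT => <-.
    have [qt|qt] := eqVneq q t.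
      by apply: sP => //; apply/sJP/ntJ; rewrite // -qt adj_sym.
    by right; apply/touchesP; exists q; rewrite // !inE qt qw qQ orbT.
(* Neither vertex exists: [t] and [z] can both be added back, which gives one vertex more than a
   maximal pair has. *)
- have vz_neq : z != v by rewrite eq_sym adj_neq.
  have indAt : independent (t |: A).
    apply: independentU1 => // x; rewrite !inE => xA; apply/negP => tx.
    have := noy x; rewrite tx /= negb_and !negbK.
    case/orP: xA => [/eqP xv|/andP[xz xP]].
      by move: (nut v wv); rewrite adj_sym -xv tx => /(_ isT) xu; rewrite -xu xv eqxx in uv.
    by rewrite (negbTE xz) orbF => /eqP xu; rewrite xu (negbTE uP) in xP.
  have indBz : independent (z |: B).
    apply: independentU1 => // x; rewrite !inE => xB; apply/negP => zx.
    have := noy' x; rewrite zx /= negb_and !negbK.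
    case/orP: xB => [/eqP xu|/and3P[xt xw xQ]].
      have := uv; rewrite xu => nuv; rewrite (negbTE nuv) /= => /eqP ut'.
      by rewrite ut' adj_irrefl in ut.
    by rewrite (negbTE xt) orbF => /eqP xv; rewrite xv (negbTE vQ) in xQ.
  have zB : z \notin B.
    rewrite !inE (negbTE zQ) !andbF orbF.
    by apply: contraNneq nwz => ->.
  have tA : t \notin A.
    rewrite !inE (negbTE tP) andbF orbF.
    by apply: contraTneq tQ => ->.
  have zt : z != t by apply: contraNneq zQ => ->.
  have : indep_pair (t |: A) (z |: B).
    rewrite /indep_pair indAt indBz disjoints_setU1 !inE (negbTE zt) eqxx (negbTE vz_neq) /=.
    rewrite disjoint_sym disjoints_setU1 disjoint_sym dAB !inE eqxx /= ?andbF ?orbF ?andbT.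
    by rewrite eq_sym adj_neq.
  move/(card_indep_pair wc)/(_ mPQ).
  by rewrite (cardsU1 t) (cardsU1 z) zB tA -cardAB !add1n addSn addnS ltnn.
Qed.

(** * Adjacencies between the second neighbors of [w], and the contradiction *)

(** A minimal [T'] meets N(u) in a single vertex [t], so some [J] disjoint from [T'] omits [t], and
    [J] can meet N(v) only in [z]. If [z] and [t] were not adjacent, their extra neighbors would
    make both sides of [exchange] true. *)
Lemma cross_partner u v z T :
    adj w v -> adj w u -> u != v -> adj v z -> z != w -> omits v z T ->
  exists t T' J, [/\ adj u t, t != w, adj z t & t \in T'] /\
    [/\ omits v z T', omits u t J, z \in J & [disjoint J & T']].
Proof.
move=> wv wu uv vz zw omT.
have [T' omT' privT'] := minimal_omits omT.
have [isoT' zT' allT'] := omitsP _ _ _ omT'.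
have [/admissibleP[_ wT' _] hitT'] := isolatingP _ isoT'.
have /touchesP[t tT' ut] := hitT' u wu.
have tw : t != w by apply: contraNneq wT' => <-.
have uniq_t : {in T', forall x, adj u x -> x = t}.
  move=> x xT' ux; have xw : x != w by apply: contraNneq wT' => <-.
  have nvx : ~~ adj v x.
    apply/negP => vx; case/eqP: xw.
    by apply: (common_neighbor girthG uv); rewrite // adj_sym.
  (* [x] is private to some [u'], and [u'] is [u] because [x] and [w] have only one common neighbor;
     so [t] equals [x]. *)
  have [u' [wu' u'x privx]] := privT' x xT' nvx.
  have uu' : u' = u.
    by apply: (common_neighbor girthG xw) => //; rewrite adj_sym.
  by rewrite (privx t tT') // uu'.
have [J omJ dT'J] := extend_omits isoT' wu tT' uniq_t.
have zJ : z \in J.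
  have [/isolatingP[/admissibleP[_ wJ _] hitJ] _ _] := omitsP _ _ _ omJ.
  have /touchesP[x xJ vx] := hitJ v wv.
  have xw : x != w by apply: contraNneq wJ => <-.
  suff <- : x = z by [].
  by apply/eqP; apply: contraTT xJ => xz; rewrite (disjointFr dT'J) // allT'.
rewrite disjoint_sym in dT'J.
exists t, T', J; split; split=> //.
apply: contraT => nzt.
have /negP[] := exchange wv wu uv vz zw ut tw omT' omJ dT'J zJ tT'.
have [y zy yv] := omits_extra_neighbor wv vz zw omT'.
have [y' ty' y'u] := omits_extra_neighbor wu ut tw omJ.
apply/eqP; transitivity true; last symmetry; apply/existsP.
  by exists y'; rewrite ty' y'u; apply: contraNneq nzt => <-; rewrite adj_sym.
by exists y; rewrite zy yv; apply: contraNneq nzt => <-.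
Qed.

(** [y] lies in a minimal set omitting [z], where it is the private neighbor of some [u]. *)
Lemma omits_neighbor_cross v z T y :
    adj w v -> adj v z -> z != w -> omits v z T -> adj z y -> y != v ->
  exists u, [/\ adj w u, u != v & adj u y].
Proof.
move=> wv vz zw omT zy yv.
have [T' omT' privT'] := minimal_omits omT.
have nvy : ~~ adj v y.
  by apply: contraL zy => vy; apply: (no_triangle girthG vz).
have [|u [wu uy _]] := privT' y _ nvy.
  exact: omits_sub_neighbors omT' _ zy yv.
exists u; split=> //; by apply: contraNneq nvy => <-.
Qed.

Lemma isolating_false v J : adj w v -> ~~ isolating J.
Proof.
move=> wv; apply/negP => isoJ.
have [/admissibleP[indJ wJ nwJ] hitJ] := isolatingP _ isoJ.
have /touchesP[z zJ vz] := hitJ v wv.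
have zw : z != w by apply: contraNneq wJ => <-.
have [T omT] : exists T, omits v z T.
  (* Thin out [J] to meet N(v) in [z] alone. No other neighbor of [w] loses domination, as it shares
     only [w] with [v]. *)
  pose J' := z |: [set x in J | ~~ adj v x].
  have sJ' : J' \subset J.
    by apply/subsetP => x /setU1P[->//|]; rewrite inE => /andP[].
  have isoJ' : isolating J'.
    apply/isolatingP; split.
      apply/admissibleP; split; first exact: independentS indJ.
        by apply: contraNN wJ; apply: (subsetP sJ').
      by move=> x /(subsetP sJ'); apply: nwJ.
    move=> u wu; have [->|uv] := eqVneq u v.
      by apply/touchesP; exists z; rewrite ?setU11.
    have /touchesP[x xJ ux] := hitJ u wu.
    apply/touchesP; exists x => //; rewrite !inE xJ.
    apply/orP; right; apply/negP => vx; case/eqP: uv.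
    have xw : x != w by apply: contraNneq wJ => <-.
    by apply: (common_neighbor girthG xw) => //; rewrite adj_sym.
  have [|T omT _] := extend_omits isoJ' wv (setU11 _ _).
    move=> x /setU1P[//|]; rewrite inE => /andP[_ nvx] vx.
    by rewrite vx in nvx.
  by exists T.
have [y zy yv] := omits_extra_neighbor wv vz zw omT.
have [u [wu uv uy]] := omits_neighbor_cross wv vz zw omT zy yv.
have [t [T' [J' [[ut tw zt tT'] [omT' omJ' zJ' dJT']]]]] :=
  cross_partner wv wu uv vz zw omT.
have vu : v != u by rewrite eq_sym.
have /negP[] := exchange wv wu uv vz zw ut tw omT' omJ' dJT' zJ' tT'.
have tz : adj t z by rewrite adj_sym.
have [/existsP[u' /and3P[wu' u'u u'v]]|/existsPn noU] :=
  boolP [exists u', [&& adj w u', u' != u & u' != v]].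
(* With a third neighbor [u'] of [w], the partner [x] of [c] in N(u') is a further neighbor: it is
   not [d], as [u'] and [b] share only [w]. Both sides of [exchange] are then true. *)
- have third a b c d S : adj w a -> adj w b -> a != b -> u' != a -> u' != b ->
      adj a c -> c != w -> adj b d -> omits a c S ->
      [exists x, [&& adj c x, x != a & x != d]].
    move=> wa wb ab u'a u'b ac cw bd omS.
    have [x [_ [_ [[u'x xw cx _] _]]]] := cross_partner wa wu' u'a ac cw omS.
    apply/existsP; exists x; rewrite cx /=; apply/andP; split.
      apply: contraTneq u'x => ->.
      exact: (no_triangle girthG wu' wa).
    apply: contraNneq xw => xd; apply/eqP; rewrite xd in u'x *.
    by apply: (common_neighbor girthG u'b); rewrite // adj_sym.
  rewrite (third u v t z J') ?(third v u z t T') //.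
(* With only two neighbors of [w], a further neighbor [x] of [c] would lie in N(b), so [b] and [c]
   would share both [x] and [d]. Both sides of [exchange] are then false. *)
- have only a b c d S : adj w a -> adj w b -> b != a -> adj a c -> c != w ->
      adj b d -> adj c d -> omits a c S ->
      (forall x, adj w x -> x != a -> x = b) ->
      [exists x, [&& adj c x, x != a & x != d]] = false.
    move=> wa wb ba ac cw bd cd omS onlyb; apply/existsP => -[x /and3P[cx xa xd]].
    have [b' [wb' b'a b'x]] := omits_neighbor_cross wa ac cw omS cx xa.
    rewrite (onlyb b') // in b'x.
    case/eqP: xd; apply: (common_neighbor girthG _ b'x cx bd cd).
    apply: contraTneq ac => <-; exact: (no_triangle girthG wa wb).
  have noU' x : adj w x -> x != u -> x = v.
    by move=> wx xu; have := noU x; rewrite wx xu /= negbK => /eqP.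
  have noV' x : adj w x -> x != v -> x = u.
    by move=> wx xv; have := noU x; rewrite wx xv andbT /= negbK => /eqP.
  by rewrite (only u v t z J') ?(only v u z t T').
Qed.

End Isolatable.

Theorem theorem3p8 (G : sgraph) (girthG : girth_at_least G 5)
    (isoG : exists2 w : G, isolatable w & ~~ isolated w) :
  ~ well_covered (prism G).
Proof.
move=> wc; have [w /isolatable_isolating[J isoJ] /forallPn[v]] := isoG.
rewrite negbK => wv.
by have := isolating_false girthG wc J wv; rewrite isoJ.
Qed.
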